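(* Let $W_\omega$ and $W_\eta$ be unilateral weighted shifts with bounded positive weight sequences $\omega,\eta$, and assume that their canonical embedding $W_{(\alpha,\beta)}$ is commuting. Then: (i) $W_{(\alpha,\beta)}$ is hyponormal $\iff$ $W_\omega$ is hyponormal $\iff$ $W_\eta$ is hyponormal; (ii) for every integer $k\ge1$: $W_{(\alpha,\beta)}$ is $k$-hyponormal $\iff$ $W_\omega$ is $k$-hyponormal $\iff$ $W_\eta$ is $k$-hyponormal; (iii) $W_{(\alpha,\beta)}$ is subnormal $\iff$ $W_\omega$ is subnormal $\iff$ $W_\eta$ is subnormal.
   Context: $W_\omega$ is the unilateral weighted shift $e_n\mapsto\omega_ne_{n+1}$ on $\ell^2(\mathbb{Z}_+)$. The canonical embedding of $(W_\omega,W_\eta)$ is the 2-variable weighted shift $(T_1,T_2)$ on $\ell^2(\mathbb{Z}_+^2)$ with $T_1e_{(k_1,k_2)}=\omega_{k_1+k_2}e_{(k_1+1,k_2)}$, $T_2e_{(k_1,k_2)}=\eta_{k_1+k_2}e_{(k_1,k_2+1)}$. A commuting tuple $(S_1,\dots,S_m)$ is hyponormal if the operator matrix $([S_j^*,S_i])_{i,j=1}^m$ is positive. A single operator $T$ is $k$-hyponormal if $(T,T^2,\dots,T^k)$ is hyponormal; a commuting pair $(T_1,T_2)$ is $k$-hyponormal if the tuple of all monomials $T_1^pT_2^q$ with $1\le p+q\le k$ is hyponormal. A commuting tuple is subnormal if it is the restriction of a commuting normal tuple to a common invariant subspace. *)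

(* Defs.v *)
From HB Require Import structures.
From mathcomp Require Import all_boot all_order all_algebra complex reals.
Set Implicit Arguments. Unset Strict Implicit. Unset Printing Implicit Defensive.
Import Order.TTheory GRing.Theory Num.Theory.
Local Open Scope ring_scope.

(* Complex Hilbert spaces, concretely: an lmodType over C = R[i] (R a
   complete archimedean ordered field, i.e. the reals) together with an
   inner product, linear in the first variable, conjugate symmetric,
   positive definite, and complete for the induced norm.
   The order on C is the partial order of numClosedFieldType:
   0 <= z means z is a nonnegative real. *)
Section Hilbert.
Variable (C : numClosedFieldType) (V : lmodType C) (ip : V -> V -> C).

Definition ip_cauchy (u : nat -> V) : Prop :=
  forall eps : C, 0 < eps -> exists N : nat, forall n m : nat,
    (N <= n)%N -> (N <= m)%N -> `|ip (u n - u m) (u n - u m)| < eps.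

Definition ip_converges (u : nat -> V) (l : V) : Prop :=
  forall eps : C, 0 < eps -> exists N : nat, forall n : nat,
    (N <= n)%N -> `|ip (u n - l) (u n - l)| < eps.

Record is_hilbert : Prop := IsHilbert {
  ip_linear_l : forall (a : C) (x y z : V), ip (a *: x + y) z = a * ip x z + ip y z;
  ip_conj_sym : forall x y : V, ip y x = (ip x y)^*;
  ip_ge0 : forall x : V, 0 <= ip x x;
  ip_definite : forall x : V, ip x x = 0 -> x = 0;
  ip_complete : forall u : nat -> V, ip_cauchy u -> exists l : V, ip_converges u l
}.

Definition is_linear (T : V -> V) : Prop :=
  forall (a : C) (x y : V), T (a *: x + y) = a *: T x + T y.

Definition is_bounded_op (T : V -> V) : Prop :=
  is_linear T /\ exists M : C, forall x : V, ip (T x) (T x) <= M * ip x x.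

Definition is_adjoint (T S : V -> V) : Prop :=
  forall x y : V, ip (T x) y = ip x (S y).

Definition is_orthonormal_basis (I : eqType) (e : I -> V) : Prop :=
  (forall i j : I, ip (e i) (e j) = (if i == j then 1 else 0)) /\
  (forall x : V, (forall i : I, ip x (e i) = 0) -> x = 0).

(* Hyponormality of an m-tuple S_0,...,S_{m-1} of operators: the operator
   matrix ([S_j^*, S_i])_{i,j} on V^m is positive, i.e.
   sum_{i,j} < [S_j^*, S_i] x_j , x_i > >= 0 for all x in V^m. *)
Definition hyponormal_tuple (m : nat) (S : 'I_m -> V -> V) : Prop :=
  forall Sa : 'I_m -> V -> V, (forall i, is_adjoint (S i) (Sa i)) ->
  forall x : 'I_m -> V,
    0 <= \sum_(i < m) \sum_(j < m)
            ip (Sa j (S i (x j)) - S i (Sa j (x j))) (x i).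

Definition hyponormal (T : V -> V) : Prop :=
  hyponormal_tuple (fun _ : 'I_1 => T).

Definition k_hyponormal (k : nat) (T : V -> V) : Prop :=
  hyponormal_tuple (fun i : 'I_k => iter i.+1 T).

Definition monomial_exps (k : nat) : seq (nat * nat) :=
  [seq (p, n - p)%N | n <- iota 1 k, p <- iota 0 n.+1].

Definition k_hyponormal_pair (k : nat) (T1 T2 : V -> V) : Prop :=
  hyponormal_tuple (fun i : 'I_(size (monomial_exps k)) =>
    let pq := nth (0, 0)%N (monomial_exps k) i in
    fun x => iter pq.1 T1 (iter pq.2 T2 x)).

Definition hyponormal_pair (T1 T2 : V -> V) : Prop :=
  hyponormal_tuple (fun i : 'I_2 => if val i == 0%N then T1 else T2).

End Hilbert.

Definition is_linear_map (C : numClosedFieldType) (U V : lmodType C)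
    (J : U -> V) : Prop :=
  forall (a : C) (x y : U), J (a *: x + y) = a *: J x + J y.

Definition is_normal_op (C : numClosedFieldType) (K : lmodType C)
    (ipK : K -> K -> C) (N : K -> K) : Prop :=
  is_bounded_op ipK N /\
  exists Na : K -> K, is_adjoint ipK N Na /\ (forall y, N (Na y) = Na (N y)).

(* A commuting m-tuple S on the Hilbert space (V, ip) is subnormal if there
   are a Hilbert space (K, ipK), an isometric linear embedding J : V -> K
   and a commuting m-tuple N of normal operators on K such that J(V) is
   invariant under every N_i and N_i restricted to J(V) is S_i
   (i.e. N_i (J x) = J (S_i x)). *)
Definition subnormal_tuple (R : realType) (V : lmodType R[i])
    (ip : V -> V -> R[i]) (m : nat) (S : 'I_m -> V -> V) : Prop :=
  exists (K : lmodType R[i]) (ipK : K -> K -> R[i]) (J : V -> K)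
         (N : 'I_m -> K -> K),
    [/\ is_hilbert ipK,
        is_linear_map J /\ (forall x y, ipK (J x) (J y) = ip x y),
        (forall i, is_normal_op ipK (N i)),
        (forall i j y, N i (N j y) = N j (N i y)) &
        (forall i x, N i (J x) = J (S i x))].

Definition subnormal (R : realType) (V : lmodType R[i])
    (ip : V -> V -> R[i]) (T : V -> V) : Prop :=
  subnormal_tuple ip (fun _ : 'I_1 => T).

Definition subnormal_pair (R : realType) (V : lmodType R[i])
    (ip : V -> V -> R[i]) (T1 T2 : V -> V) : Prop :=
  subnormal_tuple ip (fun i : 'I_2 => if val i == 0%N then T1 else T2).

Local Open Scope complex_scope.

(* W is (a unitary copy of) the unilateral weighted shift W_w on l^2(Z_+):
   e is an orthonormal basis of V and W e_n = w_n e_{n+1}, W bounded linear *)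
Definition is_weighted_shift (R : realType) (V : lmodType R[i])
    (ip : V -> V -> R[i]) (e : nat -> V) (w : nat -> R) (W : V -> V) : Prop :=
  is_orthonormal_basis ip e /\ is_bounded_op ip W /\
  forall n : nat, W (e n) = (w n)%:C *: e n.+1.

(* (T1, T2) is (a unitary copy of) the canonical embedding of (W_w, W_h)
   on l^2(Z_+^2): f is an orthonormal basis and
   T1 f_(k1,k2) = w_(k1+k2) f_(k1+1,k2), T2 f_(k1,k2) = h_(k1+k2) f_(k1,k2+1) *)
Definition is_canonical_embedding (R : realType) (V : lmodType R[i])
    (ip : V -> V -> R[i]) (f : nat * nat -> V) (w h : nat -> R)
    (T1 T2 : V -> V) : Prop :=
  [/\ is_orthonormal_basis ip f, is_bounded_op ip T1, is_bounded_op ip T2,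
      (forall k1 k2 : nat, T1 (f (k1, k2)) = (w (k1 + k2)%N)%:C *: f (k1.+1, k2)) &
      (forall k1 k2 : nat, T2 (f (k1, k2)) = (h (k1 + k2)%N)%:C *: f (k1, k2.+1))].

(* Main.v *)
(** Commutativity forces [eta = c om] for a constant [c > 0], so [Weta = c Wom]
    and the equivalences between [Wom] and [Weta] are a matter of rescaling.
    Hyponormality of a tuple [S] is positivity of the Bram form
    [sum_(i, j) <S_i x_j, S_j x_i>] over the tuple enlarged by the identity, and
    this positivity passes to isometrically embedded invariant subspaces, to
    rescaled tuples and to reindexed (even repeated) tuples.
    The shift [Wom] is the restriction of [T1] to the first row of the basis.
    Conversely [f_k |-> e_|k| (x) delta_k] embeds [(T1, T2)] isometrically in
    [(Wom (x) U1, c Wom (x) U2)] on [H (x) l^2(Z^2)], with [U1], [U2] the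
    bilateral shifts.  There the Bram form is a sum over Z^2 of Bram forms of
    powers of [Wom], and if [N] is a normal extension of [Wom] then
    [(N (x) U1, c N (x) U2)] is a commuting normal extension of the pair. *)
Require Import Defs.
From HB Require Import structures.
From mathcomp Require Import all_boot all_order all_algebra complex reals.
From mathcomp Require Import finmap boolp classical_sets functions ring lra.
Set Implicit Arguments. Unset Strict Implicit. Unset Printing Implicit Defensive.
Import Order.TTheory GRing.Theory Num.Theory.
Local Open Scope ring_scope.

Local Notation re := complex.Re.

(** * Hilbert spaces *)

Section LinearMaps.
Variables (C : numClosedFieldType) (U V : lmodType C) (A : U -> V).
Hypothesis linA : is_linear_map A.

Lemma lin_map0 : A 0 = 0.
Proof. by have := linA (-1) 0 0; rewrite scaleN1r oppr0 addr0 scaleN1r addNr. Qed.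

Lemma lin_mapD x y : A (x + y) = A x + A y.
Proof. by rewrite -[x]scale1r linA !scale1r. Qed.

Lemma lin_mapZ a x : A (a *: x) = a *: A x.
Proof. by rewrite -[a *: x]addr0 linA lin_map0 addr0. Qed.

Lemma lin_mapN x : A (- x) = - A x.
Proof. by rewrite -scaleN1r lin_mapZ scaleN1r. Qed.

Lemma lin_mapB x y : A (x - y) = A x - A y.
Proof. by rewrite lin_mapD lin_mapN. Qed.

Lemma lin_map_sum (I : Type) (r : seq I) (P : pred I) (x : I -> U) :
  A (\sum_(i <- r | P i) x i) = \sum_(i <- r | P i) A (x i).
Proof. exact: (big_morph A lin_mapD lin_map0). Qed.

End LinearMaps.

(** * Squared norms and sesquilinearity of the inner product *)

Section Nsq.
Variables (R : realType) (V : lmodType R[i]) (ip : V -> V -> R[i]).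
Local Open Scope complex_scope.

(** Real-valued, so that estimates take place in the ordered field [R]; by [ip_nsq] no information
    is lost. *)
Definition nsq (x : V) : R := re (ip x x).

Hypothesis hV : is_hilbert ip.

Lemma ip_linl y : is_linear_map (fun x => ip x y : R[i]^o).
Proof. by move=> a x z; rewrite (ip_linear_l hV). Qed.

Lemma ipC x y : ip x y = Num.conj (ip y x).
Proof. exact: ip_conj_sym hV y x. Qed.

Lemma ipDl x y z : ip (x + y) z = ip x z + ip y z.
Proof. exact: (lin_mapD (ip_linl z)). Qed.
Lemma ipZl a x z : ip (a *: x) z = a * ip x z.
Proof. exact: (lin_mapZ (ip_linl z)). Qed.
Lemma ipNl x z : ip (- x) z = - ip x z.
Proof. exact: (lin_mapN (ip_linl z)). Qed.
Lemma ip0l z : ip 0 z = 0.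
Proof. exact: (lin_map0 (ip_linl z)). Qed.
Lemma ip_suml (I : Type) (r : seq I) (P : pred I) (x : I -> V) z :
  ip (\sum_(i <- r | P i) x i) z = \sum_(i <- r | P i) ip (x i) z.
Proof. exact: (lin_map_sum (ip_linl z)). Qed.

Lemma ipDr x y z : ip z (x + y) = ip z x + ip z y.
Proof. by rewrite ![ip z _]ipC ipDl rmorphD. Qed.
Lemma ipZr a x z : ip z (a *: x) = Num.conj a * ip z x.
Proof. by rewrite ![ip z _]ipC ipZl rmorphM. Qed.
Lemma ipNr x z : ip z (- x) = - ip z x.
Proof. by rewrite ![ip z _]ipC ipNl rmorphN. Qed.
Lemma ip0r z : ip z 0 = 0.
Proof. by rewrite ipC ip0l rmorph0. Qed.
Lemma ip_sumr (I : Type) (r : seq I) (P : pred I) (x : I -> V) z :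
  ip z (\sum_(i <- r | P i) x i) = \sum_(i <- r | P i) ip z (x i).
Proof.
by rewrite ipC ip_suml rmorph_sum; apply: eq_bigr => i _; rewrite [RHS]ipC.
Qed.

Lemma ip_nsq x : ip x x = (nsq x)%:C.
Proof.
have := ip_ge0 hV x; rewrite lecE /nsq => /andP[/eqP h _].
by move: h; case: (ip x x) => a b /= ->.
Qed.

Lemma nsq_ge0 x : 0 <= nsq x.
Proof. by have := ip_ge0 hV x; rewrite lecE => /andP[]. Qed.

Lemma nsq_eq0 x : nsq x = 0 -> x = 0.
Proof. by move=> h; apply: (ip_definite hV); rewrite ip_nsq h. Qed.

Lemma nsq0 : nsq 0 = 0.
Proof. by rewrite /nsq ip0l. Qed.

Lemma nsqN x : nsq (- x) = nsq x.
Proof. by rewrite /nsq ipNl ipNr opprK. Qed.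

Lemma nsq_sub x y : nsq (x - y) = nsq (y - x).
Proof. by rewrite -nsqN opprB. Qed.

(** The parallelogram law with the term [nsq (x - y)] dropped; it stands in for the triangle
    inequality and avoids square roots. *)
Lemma nsqD_le x y : nsq (x + y) <= 2 * nsq x + 2 * nsq y.
Proof.
have h := nsq_ge0 (x - y).
have e : nsq (x + y) + nsq (x - y) = 2 * nsq x + 2 * nsq y.
  have -> : forall a b : R[i], re a + re b = re (a + b) by move=> [? ?] [? ?].
  rewrite !ipDl !ipDr !ipNl !ipNr !ip_nsq /nsq.
  by case: (ip x y) (ip y x) => [? ?] [? ?] /=; ring.
lra.
Qed.

Lemma nsqB_le x y z : nsq (x - z) <= 2 * nsq (x - y) + 2 * nsq (y - z).
Proof. by rewrite -[x - z](subrKA y); apply: nsqD_le. Qed.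

End Nsq.

(** * Convergence and completeness with real tolerances *)

Section EpsilonReal.
Variables (R : realType) (V : lmodType R[i]) (ip : V -> V -> R[i]).
Local Open Scope complex_scope.

Lemma gt0_complex (eps : R[i]) : 0 < eps -> 0 < re eps /\ eps = (re eps)%:C.
Proof. by case: eps => a b; rewrite ltcE /= => /andP[/eqP -> ->]. Qed.

Lemma norm_ip_lt x (eps : R) : (ip x x = (nsq ip x)%:C) -> 0 <= nsq ip x ->
  (`|ip x x| < eps%:C) = (nsq ip x < eps).
Proof. by move=> -> h; rewrite ger0_norm ?ltcR // ler0c. Qed.

End EpsilonReal.

Section HilbertSequences.
Variables (R : realType) (V : lmodType R[i]) (ip : V -> V -> R[i]).
Hypothesis hV : is_hilbert ip.
Local Open Scope complex_scope.

Lemma ip_convergesP u l : ip_converges ip u l <->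
  forall eps : R, 0 < eps -> exists N : nat, forall n, (N <= n)%N ->
    nsq ip (u n - l) < eps.
Proof.
split=> h eps e0.
  have [|N hN] := h eps%:C; first by rewrite ltcR.
  by exists N => n /hN; rewrite norm_ip_lt ?nsq_ge0 -?ip_nsq.
have [r0 ->] := gt0_complex e0.
have [N hN] := h _ r0.
by exists N => n /hN; rewrite norm_ip_lt ?nsq_ge0 -?ip_nsq.
Qed.

Lemma hilbert_complete (u : nat -> V) :
  (forall eps : R, 0 < eps -> exists N : nat, forall n m,
     (N <= n)%N -> (N <= m)%N -> nsq ip (u n - u m) < eps) ->
  exists l, forall eps : R, 0 < eps -> exists N : nat, forall n,
    (N <= n)%N -> nsq ip (u n - l) < eps.
Proof.
move=> h; have [|l /ip_convergesP] := ip_complete hV (u := u); last by exists l.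
move=> eps /gt0_complex[r0 ->]; have [N hN] := h _ r0.
by exists N => n m nN mN; rewrite norm_ip_lt ?nsq_ge0 -?ip_nsq //; apply: hN.
Qed.

End HilbertSequences.

Section IsHilbert.
Variables (R : realType) (V : lmodType R[i]) (ip : V -> V -> R[i]).
Local Open Scope complex_scope.

Lemma is_hilbert_intro :
  (forall (a : R[i]) (x y z : V), ip (a *: x + y) z = a * ip x z + ip y z) ->
  (forall x y : V, ip y x = Num.conj (ip x y)) ->
  (forall x : V, 0 <= ip x x) ->
  (forall x : V, ip x x = 0 -> x = 0) ->
  (forall u : nat -> V,
    (forall eps : R, 0 < eps -> exists N : nat, forall n m,
     (N <= n)%N -> (N <= m)%N -> nsq ip (u n - u m) < eps) ->
    exists l, forall eps : R, 0 < eps -> exists N : nat, forall n,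
      (N <= n)%N -> nsq ip (u n - l) < eps) ->
  is_hilbert ip.
Proof.
move=> hlin hC h0 hd hc.
have q x : 0 <= nsq ip x by have := h0 x; rewrite lecE => /andP[].
have e x : ip x x = (nsq ip x)%:C.
  have := h0 x; rewrite lecE /nsq => /andP[/eqP h _].
  by move: h; case: (ip x x) => a b /= ->.
split=> // u hu; have [|l hl] := hc u.
  move=> eps e0; have [|N hN] := hu eps%:C; first by rewrite ltcR.
  by exists N => n m nN mN; rewrite -norm_ip_lt //; apply: hN.
exists l => eps /gt0_complex[r0 ->]; have [N hN] := hl _ r0.
by exists N => n nN; rewrite norm_ip_lt //; apply: hN.
Qed.

End IsHilbert.

(** * The scalars as a one-dimensional Hilbert space *)

Section Scalars.
Variable R : realType.
Local Open Scope complex_scope.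

(** Makes functionals bounded maps into a Hilbert space and numerical series an instance of vector
    series. *)
Definition cip (a b : R[i]^o) : R[i] := a * Num.conj b.

Lemma nsq_cip (a : R[i]) : nsq cip a = re a ^+ 2 + complex.Im a ^+ 2.
Proof. by rewrite /nsq /cip /=; case: a => a b /=; ring. Qed.

(** The limit is the supremum of the set [E] of eventual lower bounds: from some index on,
    [u n - eps] lies in [E] and [u n + eps] bounds [E] from above. *)
Lemma real_cauchy_complete (u : nat -> R) :
  (forall eps : R, 0 < eps -> exists N : nat, forall n m,
     (N <= n)%N -> (N <= m)%N -> `|u n - u m| < eps) ->
  exists l, forall eps : R, 0 < eps -> exists N : nat, forall n,
    (N <= n)%N -> `|u n - l| <= eps.
Proof.
move=> hu.
pose E : set R := fun r => exists N, forall n, (N <= n)%N -> r <= u n.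
have hE eps : 0 < eps -> exists N, forall n, (N <= n)%N ->
    E (u n - eps) /\ ubound E (u n + eps).
  move=> e0; have [N hN] := hu _ e0; exists N => n nN; split.
    by exists N => m mN; have := hN _ _ nN mN; rewrite ltr_norml; lra.
  move=> r [M hM]; have mM := hM _ (leq_maxl M N).
  by have := hN _ _ nN (leq_maxr M N); rewrite ltr_norml; lra.
have [N1 hN1] := hE 1 ltr01; have [e1 b1] := hN1 _ (leqnn _).
have sE : has_sup E by split; [exists (u N1 - 1) | exists (u N1 + 1)].
exists (sup E) => eps e0; have [N hN] := hE _ e0; exists N => n nN.
have [/(ub_le_sup sE.2) h1 h2] := hN _ nN.
have := ge_sup sE.1 h2.
by rewrite ler_norml; lra.
Qed.

Lemma cip_hilbert : is_hilbert cip.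
Proof.
apply: is_hilbert_intro.
- by move=> a x y z; rewrite /cip mulrDl mulrA.
- by move=> x y; rewrite /cip mulrC -{1}[y]conjCK -rmorphM.
- by move=> x; rewrite /cip mul_conjC_ge0.
- by move=> x /eqP; rewrite /cip mul_conjC_eq0 => /eqP.
move=> u hu.
have sq_lt (a e : R) : 0 < e -> a ^+ 2 < e ^+ 2 -> `|a| < e.
  by move=> e0; rewrite -[a ^+ 2]real_normK ?num_real // ltr_pXn2r ?nnegrE ?normr_ge0 ?ltW.
have [|a ha] := @real_cauchy_complete (fun n => re (u n)).
  move=> eps e0; have [|N hN] := hu (eps ^+ 2); first by rewrite exprn_gt0.
  exists N => n m nN mN; apply: sq_lt => //; have := hN _ _ nN mN.
  rewrite nsq_cip; case: (u n) (u m) => [? b] [? d] /=.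
  by have := sqr_ge0 (b - d); lra.
have [|b hb] := @real_cauchy_complete (fun n => complex.Im (u n)).
  move=> eps e0; have [|N hN] := hu (eps ^+ 2); first by rewrite exprn_gt0.
  exists N => n m nN mN; apply: sq_lt => //; have := hN _ _ nN mN.
  rewrite nsq_cip; case: (u n) (u m) => [b ?] [d ?] /=.
  by have := sqr_ge0 (b - d); lra.
exists (Complex a b) => eps e0.
(* As [d <= 1], a coordinate error of at most [d] has square at most [d <= eps / 4]. *)
pose d := Num.min 1 (eps / 4).
have d0 : 0 < d by rewrite lt_min ltr01 divr_gt0.
have [N1 h1] := ha _ d0; have [N2 h2] := hb _ d0.
exists (maxn N1 N2) => n; rewrite geq_max => /andP[/h1 k1 /h2 k2].
rewrite nsq_cip; move: k1 k2; case: (u n) => [x y] /= k1 k2.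
have sq (t : R) : `|t| <= d -> t ^+ 2 <= eps / 4.
  rewrite le_min => /andP[t1 t2]; rewrite -[t ^+ 2]real_normK ?num_real //.
  by have := normr_ge0 t; nra.
by have := sq _ k1; have := sq _ k2; lra.
Qed.

Lemma nsq_cipJ (a : R[i]) : nsq cip (Num.conj a) = nsq cip a.
Proof. by rewrite !nsq_cip; case: a => [? ?] /=; ring. Qed.

Lemma nsq_cip_real (a : R) : nsq cip (a%:C) = a ^+ 2.
Proof. by rewrite nsq_cip /=; ring. Qed.

End Scalars.
Arguments cip {R}.

(** * The Cauchy-Schwarz inequality *)

Section CauchySchwarz.
Variables (R : realType) (V : lmodType R[i]) (ip : V -> V -> R[i]).
Hypothesis hV : is_hilbert ip.
Local Open Scope complex_scope.

Lemma nsqZ a x : nsq ip (a *: x) = nsq cip a * nsq ip x.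
Proof.
rewrite {1}/nsq (ipZl hV) (ipZr hV) (ip_nsq hV) nsq_cip.
by case: a => ? ? /=; ring.
Qed.

Lemma cauchy_schwarz x y : nsq cip (ip x y) <= nsq ip x * nsq ip y.
Proof.
have [/(nsq_eq0 hV) ->|y0] := eqVneq (nsq ip y) 0.
  by rewrite (ip0r hV) !nsq0 ?mulr0 //; exact: cip_hilbert.
have yp : 0 < nsq ip y by rewrite lt_def y0 nsq_ge0.
(* This vector is [nsq ip y] times the component of [x] orthogonal to [y]. *)
have := nsq_ge0 hV ((nsq ip y)%:C *: x - ip x y *: y).
suff -> : nsq ip ((nsq ip y)%:C *: x - ip x y *: y) =
    nsq ip y * (nsq ip x * nsq ip y - nsq cip (ip x y)).
  by rewrite pmulr_rge0 // subr_ge0.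
rewrite {1}/nsq !(ipDl hV) !(ipDr hV) !(ipNl hV) !(ipNr hV) !(ipZl hV) !(ipZr hV).
rewrite [ip y x](ipC hV) !(ip_nsq hV) nsq_cip.
by case: (ip x y) => ? ? /=; ring.
Qed.

End CauchySchwarz.

(** Unlike [is_bounded_op], this allows two different spaces, hence functionals, coordinates and
    embeddings, and takes a nonnegative real bound. *)
Definition bounded_linear (R : realType) (U V : lmodType R[i])
    (ipU : U -> U -> R[i]) (ipV : V -> V -> R[i]) (A : U -> V) : Prop :=
  is_linear_map A /\
  exists2 M : R, 0 <= M & forall x, nsq ipV (A x) <= M * nsq ipU x.

Section BoundedLinear.
Variables (R : realType) (U V W : lmodType R[i]).
Variables (ipU : U -> U -> R[i]) (ipV : V -> V -> R[i]) (ipW : W -> W -> R[i]).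
Hypotheses (hU : is_hilbert ipU) (hV : is_hilbert ipV) (hW : is_hilbert ipW).

Lemma bounded_linear_comp (A : U -> V) (B : V -> W) :
  bounded_linear ipU ipV A -> bounded_linear ipV ipW B ->
  bounded_linear ipU ipW (B \o A).
Proof.
move=> [lA [M M0 hM]] [lB [N N0 hN]]; split; first by move=> a x y /=; rewrite lA lB.
exists (N * M) => [|x /=]; first exact: mulr_ge0.
by apply: (le_trans (hN _)); rewrite -mulrA ler_wpM2l.
Qed.

Lemma bounded_linear_scale (A : U -> V) (a : R[i]) :
  bounded_linear ipU ipV A -> bounded_linear ipU ipV (fun x => a *: A x).
Proof.
move=> [lA [M M0 hM]]; split.
  by move=> b x y; rewrite lA scalerDr !scalerA mulrC.
exists (nsq cip a * M) => [|x]; first by rewrite mulr_ge0 // nsq_ge0 //; exact: cip_hilbert.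
rewrite (nsqZ hV) -mulrA ler_wpM2l // nsq_ge0 //; exact: cip_hilbert.
Qed.

Lemma bounded_linear_ip y : bounded_linear ipV cip (fun x => ipV x y : R[i]^o).
Proof.
split; first exact: ip_linl.
by exists (nsq ipV y) => [|x]; rewrite ?(nsq_ge0 hV) // mulrC cauchy_schwarz.
Qed.

Lemma isometry_bounded_linear (J : U -> V) : is_linear_map J ->
  (forall x y, ipV (J x) (J y) = ipU x y) -> bounded_linear ipU ipV J.
Proof.
by move=> lJ iJ; split=> //; exists 1 => // x; rewrite mul1r /nsq iJ.
Qed.

Lemma bounded_linear_op (T : U -> U) :
  is_bounded_op ipU T <-> bounded_linear ipU ipU T.
Proof.
split=> [[lT [M hM]]|[lT [M M0 hM]]]; split=> //.
  exists `|re M| => // x; have := hM x; rewrite !(ip_nsq hU) lecE => /andP[_].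
  have := ler_norm (re M); have := nsq_ge0 hU x.
  by case: M {hM} => a b /=; nra.
by exists (real_complex R M) => x; rewrite !(ip_nsq hU) -rmorphM lecR.
Qed.

End BoundedLinear.

(** * Unordered sums *)

Section VectorSums.
Variables (R : realType) (I : choiceType).

(** Convergence of the net of finite partial sums: it depends on no enumeration of [I], so it is
    invariant under bijections of [I]. *)
Definition vsum (V : lmodType R[i]) (ip : V -> V -> R[i]) (x : I -> V) (l : V) :=
  forall eps : R, 0 < eps -> exists F : {fset I}, forall F' : {fset I},
    (F `<=` F')%fset -> nsq ip (\sum_(i <- F') x i - l) < eps.

Section OneSpace.
Variables (V : lmodType R[i]) (ip : V -> V -> R[i]).
Hypothesis hV : is_hilbert ip.

Lemma vsum_uniq x l m : vsum ip x l -> vsum ip x m -> l = m.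
Proof.
move=> hl hm; apply/eqP; rewrite -subr_eq0; apply/eqP/(nsq_eq0 hV)/eqP.
rewrite eq_le (nsq_ge0 hV) andbT leNgt; apply/negP => h.
have e0 : 0 < nsq ip (l - m) / 4 by rewrite divr_gt0.
have [F hF] := hl _ e0; have [G hG] := hm _ e0.
have := hF _ (fsubsetUl F G); have := hG _ (fsubsetUr F G).
set s := \sum_(i <- _) _; rewrite [nsq ip (s - l)](nsq_sub hV).
by have := nsqB_le hV l s m; lra.
Qed.

Lemma vsumD x y l m : vsum ip x l -> vsum ip y m ->
  vsum ip (fun i => x i + y i) (l + m).
Proof.
move=> hl hm eps e0; have e4 : 0 < eps / 4 by rewrite divr_gt0.
have [F hF] := hl _ e4; have [G hG] := hm _ e4.
exists (F `|` G)%fset => F' FG; rewrite big_split /= opprD addrACA.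
have := hF _ (fsubset_trans (fsubsetUl F G) FG).
have := hG _ (fsubset_trans (fsubsetUr F G) FG).
set a := _ - l; set b := _ - m; have := nsqD_le hV a b; lra.
Qed.

Lemma vsum_fin x (F : {fset I}) : (forall i, i \notin F -> x i = 0) ->
  vsum ip x (\sum_(i <- F) x i).
Proof.
move=> h eps e0; exists F => F' FF'.
suff -> : \sum_(i <- F') x i = \sum_(i <- F) x i by rewrite subrr (nsq0 hV).
by rewrite [RHS](big_fset_incl _ FF') // => i _ /h.
Qed.

Lemma sum_fsetD (W : zmodType) (x : I -> W) (A B : {fset I}) : (A `<=` B)%fset ->
  \sum_(i <- B) x i = \sum_(i <- A) x i + \sum_(i <- (B `\` A)%fset) x i.
Proof.
move=> AB; rewrite (big_fsetID _ (mem A) B) /=; congr (_ + _).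
  apply: eq_fbigl => i; rewrite !inE /= andbC.
  by case: (boolP (i \in A)) => // /(fsubsetP AB).
by apply: eq_fbigl => i; rewrite !inE /= andbC.
Qed.

(** Cauchy criterion: sets [F n] for the tolerances [1 / (n + 1)] give a Cauchy sequence of partial
    sums, whose limit is the limit of the whole net. *)
Lemma vsum_summable x :
  (forall eps : R, 0 < eps -> exists F : {fset I}, forall F' : {fset I},
    [disjoint F' & F]%fset -> nsq ip (\sum_(i <- F') x i) < eps) ->
  exists l, vsum ip x l.
Proof.
move=> h.
have hd (n : nat) : 0 < n.+1%:R^-1 :> R by rewrite invr_gt0 ltr0n.
have [F hF] := choice (fun n => h _ (hd n)).
have small (eps : R) : 0 < eps ->
    exists N : nat, forall n, (N <= n)%N -> n.+1%:R^-1 < eps :> R.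
  move=> e0; exists (Num.bound eps^-1) => n nN.
  rewrite -[eps]invrK ltf_pV2 ?posrE ?invr_gt0 ?ltr0n //.
  have /(fun h => h (ltW _)) := @archi_boundP R eps^-1.
  rewrite invr_gt0 => /(_ e0)/lt_le_trans; apply.
  by rewrite ler_nat ltnW.
have key n (G : {fset I}) : (F n `<=` G)%fset ->
    nsq ip (\sum_(i <- G) x i - \sum_(i <- F n) x i) < n.+1%:R^-1.
  move=> FG; rewrite (sum_fsetD _ FG) addrC addKr; apply: hF.
  by apply/fdisjointP => i; rewrite inE => /andP[].
pose u n := \sum_(i <- F n) x i.
have [|l hl] := hilbert_complete hV (u := u).
  move=> eps e0; have [|N hN] := small (eps / 4); first by rewrite divr_gt0.
  exists N => n m /hN kn /hN km.
  have := lt_trans (key _ _ (fsubsetUl (F n) (F m))) kn.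
  have := lt_trans (key _ _ (fsubsetUr (F n) (F m))) km.
  rewrite -/(u n) -/(u m); set s := \sum_(i <- _) _; rewrite [nsq ip (s - u n)](nsq_sub hV).
  by have := nsqB_le hV (u n) s (u m); lra.
exists l => eps e0; have e4 : 0 < eps / 4 by rewrite divr_gt0.
have [N hN] := small _ e4; have [M hM] := hl _ e4.
have := hM _ (leq_maxr N M); have := hN _ (leq_maxl N M).
set n := maxn N M => h1 h2.
exists (F n) => G /key/lt_trans/(_ h1); rewrite -/(u n).
by have := nsqB_le hV (\sum_(i <- G) x i) (u n) l; lra.
Qed.

End OneSpace.

Lemma vsum_map (V W : lmodType R[i]) (ipV : V -> V -> R[i]) (ipW : W -> W -> R[i])
    (A : V -> W) x l : is_hilbert ipV ->
  bounded_linear ipV ipW A -> vsum ipV x l -> vsum ipW (A \o x) (A l).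
Proof.
move=> hV [lA [M M0 hM]] hl eps e0; have M1 : 0 < M + 1 by lra.
have [|F hF] := hl (eps / (M + 1)); first by rewrite divr_gt0.
exists F => F' /hF; rewrite ltr_pdivlMr // => h.
rewrite /= -(lin_map_sum lA) -(lin_mapB lA).
apply: le_lt_trans h; set z := _ - l.
by have := hM z; have := nsq_ge0 hV z; nra.
Qed.

Lemma vsum_sum (V : lmodType R[i]) (ip : V -> V -> R[i]) (J : Type) (r : seq J)
    (x : J -> I -> V) (l : J -> V) : is_hilbert ip ->
  (forall j, vsum ip (x j) (l j)) ->
  vsum ip (fun i => \sum_(j <- r) x j i) (\sum_(j <- r) l j).
Proof.
move=> hV h; elim: r => [|j r IH].
  rewrite big_nil; under [X in vsum _ X]eq_fun do rewrite big_nil.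
  by move=> eps e0; exists fset0 => F _; rewrite big1 // subrr nsq0.
rewrite big_cons; under [X in vsum _ X]eq_fun do rewrite big_cons.
exact: vsumD.
Qed.

Lemma vsum_reindex (V : lmodType R[i]) (ip : V -> V -> R[i]) (h : I -> I)
    x l : bijective h -> vsum ip x l -> vsum ip (x \o h) l.
Proof.
move=> [g hK gK] hl eps e0; have [F hF] := hl _ e0.
exists (g @` F)%fset => F' gF.
have := hF (h @` F')%fset; rewrite big_imfset /=; last first.
  by move=> i j _ _ /(can_inj hK).
apply; apply/fsubsetP => i iF; apply/imfsetP; exists (g i); rewrite ?gK //.
by apply: (fsubsetP gF); apply/imfsetP; exists i.
Qed.

Lemma vsum_conj (a : I -> R[i]) s :
  vsum cip a s -> vsum cip (fun i => Num.conj (a i) : R[i]^o) (Num.conj s).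
Proof.
move=> h eps /h[F hF]; exists F => F' /hF.
by rewrite -nsq_cipJ rmorphB rmorph_sum.
Qed.

(** All partial sums are nonnegative reals; a nonzero imaginary part or a negative real part of [s]
    would keep them at a fixed distance from [s]. *)
Lemma vsum_ge0 (a : I -> R[i]) s : (forall i, 0 <= a i) ->
  vsum cip a s -> 0 <= s.
Proof.
move=> a0 h; rewrite lecE /=.
have key eps : 0 < eps -> complex.Im s ^+ 2 < eps /\ (re s < 0 -> re s ^+ 2 < eps).
  move=> /h[F] /(_ F (fsubset_refl F)); rewrite nsq_cip.
  have : 0 <= \sum_(i <- F) a i by apply: sumr_ge0.
  rewrite lecE; case: (\sum_(i <- F) a i) => p q /= /andP[/eqP -> p0].
  case: s {h} => x y /= k.
  split; [have := sqr_ge0 (p - x) | move=> x0; have := sqr_ge0 (0 - y)]; nra.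
apply/andP; split.
  rewrite -sqrf_eq0 eq_le sqr_ge0 andbT leNgt; apply/negP => i0.
  by have [] := key _ i0; rewrite ltxx.
rewrite leNgt; apply/negP => r0.
have r2 : 0 < re s ^+ 2 by rewrite exprn_even_gt0 //= lt_eqF.
by have [_ /(_ r0)] := key _ r2; rewrite ltxx.
Qed.

(** Take [F] whose sum is within [eps] of the supremum of all finite sums; a set disjoint from [F]
    can add less than [eps]. *)
Lemma sum_tail (r : I -> R) M : (forall i, 0 <= r i) ->
  (forall F : {fset I}, \sum_(i <- F) r i <= M) ->
  forall eps : R, 0 < eps -> exists F : {fset I}, forall F' : {fset I},
    [disjoint F' & F]%fset -> \sum_(i <- F') r i < eps.
Proof.
move=> r0 hM eps e0.
pose E : set R := fun t => exists F : {fset I}, t = \sum_(i <- F) r i.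
have ubE : ubound E M by move=> _ [F ->].
have sE : has_sup E by split; [exists (\sum_(i <- fset0) r i); exists fset0 | exists M].
have [_ [F ->] hF] := sup_adherent e0 sE.
exists F => F' dF.
have /(ub_le_sup sE.2) : E (\sum_(i <- (F `|` F')%fset) r i) by exists (F `|` F')%fset.
rewrite (sum_fsetD _ (fsubsetUl F F')) fsetDUl fsetDv fset0U.
suff -> : (F' `\` F)%fset = F' by lra.
by apply/fsetDidPl.
Qed.

End VectorSums.

(** * Orthonormal bases *)

Section Orthonormal.
Variables (R : realType) (I : choiceType) (V : lmodType R[i]).
Variables (ip : V -> V -> R[i]) (g : I -> V).
Hypothesis hV : is_hilbert ip.
Hypothesis og : forall i j, ip (g i) (g j) = (if i == j then 1 else 0).

Lemma ip_orthonormal_sum (F : {fset I}) (c : I -> R[i]) j :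
  ip (\sum_(i <- F) c i *: g i) (g j) = if j \in F then c j else 0.
Proof.
rewrite (ip_suml hV); under eq_bigr do rewrite (ipZl hV) og.
case: ifPn => [jF|jF].
  rewrite (big_fsetD1 j jF) /= eqxx mulr1 big1_fset ?addr0 // => i.
  by rewrite !inE => /andP[/negPf -> _]; rewrite mulr0.
rewrite big1_fset // => i iF _; case: eqP => [e|]; last by rewrite mulr0.
by rewrite -e iF in jF.
Qed.

Lemma nsq_orthonormal_sum (F : {fset I}) (c : I -> R[i]) :
  nsq ip (\sum_(i <- F) c i *: g i) = \sum_(i <- F) nsq cip (c i).
Proof.
rewrite /nsq (ip_sumr hV) [LHS](raddf_sum (@complex.Re R : Rcomplex R -> R)).
apply: eq_big_seq => i iF; rewrite (ipZr hV) ip_orthonormal_sum iF.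
by rewrite /cip mulrC.
Qed.

(** Expand [0 <= nsq ip (x - y)] for the projection [y] of [x] onto the span of the [g i] with [i]
    in [F], where [ip y x = ip y y]. *)
Lemma bessel x (F : {fset I}) : \sum_(i <- F) nsq cip (ip x (g i)) <= nsq ip x.
Proof.
set S := \sum_(i <- F) _.
pose y := \sum_(i <- F) ip x (g i) *: g i.
have yx : ip y x = real_complex R S.
  rewrite /y (ip_suml hV) rmorph_sum; apply: eq_bigr => i _.
  by rewrite (ipZl hV) [ip (g i) x](ipC hV) -[LHS]/(cip _ _) (ip_nsq (@cip_hilbert R)).
have yy : ip y y = real_complex R S.
  by rewrite (ip_nsq hV) nsq_orthonormal_sum.
have := nsq_ge0 hV (x - y).
rewrite {1}/nsq (ipDl hV) !(ipDr hV) !(ipNl hV) !(ipNr hV) (ipC hV x y) yx yy.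
by rewrite (ip_nsq hV) /=; lra.
Qed.

Lemma orthonormal_summable (c : I -> R[i]) M :
  (forall F : {fset I}, \sum_(i <- F) nsq cip (c i) <= M) ->
  exists l, vsum ip (fun i => c i *: g i) l.
Proof.
move=> hM; apply: (vsum_summable hV) => eps e0.
have c0 i : 0 <= nsq cip (c i) by apply: nsq_ge0; exact: cip_hilbert.
have [F hF] := sum_tail c0 hM e0.
by exists F => F' /hF; rewrite nsq_orthonormal_sum.
Qed.

Lemma vsum_delta (c : I -> R[i]) j :
  vsum cip (fun i => c i * ip (g i) (g j) : R[i]^o) (c j).
Proof.
have -> : c j = \sum_(i <- [fset j]%fset) c i * ip (g i) (g j).
  by rewrite big_seq_fset1 og eqxx mulr1.
apply: vsum_fin => [|i]; first exact: cip_hilbert.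
by rewrite inE og => /negPf ->; rewrite mulr0.
Qed.

(** Pairing with [g j] is bounded, so it passes through the sum, where only the term of index [j]
    survives. *)
Lemma orthonormal_coef (c : I -> R[i]) l j :
  vsum ip (fun i => c i *: g i) l -> ip l (g j) = c j.
Proof.
move=> /(vsum_map hV (bounded_linear_ip hV (g j))) h.
apply: (vsum_uniq (@cip_hilbert R) h).
have -> : (fun x => ip x (g j)) \o (fun i => c i *: g i) =
    (fun i => c i * ip (g i) (g j)) by apply/funext => i /=; rewrite (ipZl hV).
exact: vsum_delta.
Qed.

End Orthonormal.

(** * Fourier expansions, and maps determined or constructed on a basis *)

Section Fourier.
Variables (R : realType) (I : choiceType) (V : lmodType R[i]).
Variables (ip : V -> V -> R[i]) (f : I -> V).
Hypothesis hV : is_hilbert ip.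
Hypothesis bf : is_orthonormal_basis ip f.

(** The series converges by Bessel's inequality; its sum has the same coefficients as [x], so the
    two agree by totality of the basis. *)
Lemma fourier x : vsum ip (fun i => ip x (f i) *: f i) x.
Proof.
have [onf cf] := bf.
have [l hl] := orthonormal_summable hV onf (bessel hV onf x).
suff e : l = x by rewrite e in hl.
apply/eqP; rewrite -subr_eq0; apply/eqP/cf => i.
by rewrite (ipDl hV) (ipNl hV) (orthonormal_coef hV onf _ hl) subrr.
Qed.

(** Both maps pass through the Fourier series. Operator identities below are thereby reduced to
    basis vectors. *)
Lemma bounded_linear_ext (W : lmodType R[i]) (ipW : W -> W -> R[i]) (A B : V -> W) :
  is_hilbert ipW -> bounded_linear ip ipW A -> bounded_linear ip ipW B ->
  (forall i, A (f i) = B (f i)) -> A =1 B.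
Proof.
move=> hW hA hB AB x.
apply: (vsum_uniq hW (vsum_map hV hA (fourier x))).
have -> : A \o (fun i => ip x (f i) *: f i) = B \o (fun i => ip x (f i) *: f i).
  by apply/funext => i /=; rewrite (lin_mapZ hA.1) (lin_mapZ hB.1) AB.
exact: (vsum_map hV hB (fourier x)).
Qed.

(** The image of [y] is the series with coefficients [ip y (T (f i))]. A partial sum [z] satisfies
    [nsq z = ip (T z) y], so Cauchy-Schwarz gives [nsq z <= M * nsq y], which makes the series
    converge. *)
Lemma adjoint_exists (T : V -> V) : bounded_linear ip ip T ->
  exists Ta, is_adjoint ip T Ta.
Proof.
move=> bT; have [lT [M M0 hM]] := bT; have [onf _] := bf.
suff h y : exists z, forall i, ip z (f i) = ip y (T (f i)).
  have [Ta hTa] := choice h; exists Ta => x y.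
  have := bounded_linear_ext (@cip_hilbert R)
    (bounded_linear_comp bT (bounded_linear_ip hV y)) (bounded_linear_ip hV (Ta y)).
  by apply => i /=; rewrite (ipC hV) -hTa -(ipC hV).
have [|l hl] := orthonormal_summable hV onf (c := fun i => ip y (T (f i)))
  (M := M * nsq ip y).
  move=> F; set S := \sum_(i <- F) _.
  have S0 : 0 <= S by apply: sumr_ge0 => i _; apply: nsq_ge0; exact: cip_hilbert.
  pose z := \sum_(i <- F) ip y (T (f i)) *: f i.
  have zz : nsq ip z = S by rewrite nsq_orthonormal_sum.
  have Tzy : ip (T z) y = real_complex R S.
    rewrite /z (lin_map_sum lT) (ip_suml hV) rmorph_sum; apply: eq_bigr => i _.
    rewrite (lin_mapZ lT) (ipZl hV) [ip (T _) y](ipC hV) -[LHS]/(cip _ _).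
    by rewrite (ip_nsq (@cip_hilbert R)).
  have := cauchy_schwarz hV (T z) y; rewrite Tzy nsq_cip_real => h.
  have := hM z; rewrite zz => h2; have y0 := nsq_ge0 hV y.
  have {h h2} : S ^+ 2 <= M * S * nsq ip y by apply: (le_trans h); rewrite ler_wpM2r.
  by move: S0; rewrite le_eqVlt => /predU1P[<-|S0]; [rewrite mulr_ge0 | nra].
by exists l => i; rewrite (orthonormal_coef hV onf _ hl).
Qed.

(** [J x] is the sum of the [ip x (f i) *: g i]. Expanding [x] in either space gives the same series
    for [ipW (J x) (J y)] and [ip x y]. *)
Lemma isometry_extension (W : lmodType R[i]) (ipW : W -> W -> R[i]) (g : I -> W) :
  is_hilbert ipW ->
  (forall i j, ipW (g i) (g j) = (if i == j then 1 else 0)) ->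
  exists J : V -> W, [/\ is_linear_map J, (forall x y, ipW (J x) (J y) = ip x y) &
    forall i, J (f i) = g i].
Proof.
move=> hW og; have [onf _] := bf.
have h x : exists l, vsum ipW (fun i => ip x (f i) *: g i) l.
  by apply: (orthonormal_summable hW og (M := nsq ip x)); apply: bessel.
have [J hJ] := choice h.
have cJ x j : ipW (J x) (g j) = ip x (f j) by rewrite (orthonormal_coef hW og _ (hJ x)).
exists J; split.
- move=> a x y; apply: (vsum_uniq hW (hJ _)).
  have ba : bounded_linear ipW ipW (fun z => a *: z).
    by apply: (bounded_linear_scale hW _ (A := id)); apply: isometry_bounded_linear.
  have := vsumD hW (vsum_map hW ba (hJ x)) (hJ y).
  congr (vsum _ _ _); apply/funext => i /=.
  by rewrite (ipDl hV) (ipZl hV) scalerDl scalerA.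
- move=> x y; have := vsum_map hW (bounded_linear_ip hW (J y)) (hJ x).
  move=> /(vsum_uniq (@cip_hilbert R)); apply.
  have := vsum_map hV (bounded_linear_ip hV y) (fourier x).
  congr (vsum _ _ _); apply/funext => i /=.
  by rewrite (ipZl hV) (ipZl hW) [ip (f i) y](ipC hV) -(cJ y i) -(ipC hW).
move=> j; apply: (vsum_uniq hW (hJ _)).
have -> : g j = \sum_(i <- [fset j]%fset) ip (f j) (f i) *: g i.
  by rewrite big_seq_fset1 onf eqxx scale1r.
apply: vsum_fin => // i; rewrite inE onf eq_sym => /negPf ->.
by rewrite scale0r.
Qed.

End Fourier.

(** * The space l^2(I, K) *)

Lemma norm_le_real (R : realType) (a : R[i]) (r : R) : 0 <= r ->
  (`|a| <= real_complex R r) = (nsq cip a <= r ^+ 2).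
Proof.
move=> r0; rewrite nsq_cip; case: a => a b /=.
rewrite -[X in X <= _]/(real_complex R (Num.sqrt (a ^+ 2 + b ^+ 2))) lecR.
have s0 : 0 <= a ^+ 2 + b ^+ 2 by rewrite addr_ge0 ?sqr_ge0.
by rewrite -[X in _ = (X <= _)]sqr_sqrtr // ler_pXn2r // nnegrE ?sqrtr_ge0.
Qed.

Section Ell2.
Variables (R : realType) (I : choiceType) (K : lmodType R[i]).
Variables (ip : K -> K -> R[i]) (hK : is_hilbert ip).

Definition square_summable (x : I -> K) : Prop :=
  exists M : R, forall F : {fset I}, \sum_(i <- F) nsq ip (x i) <= M.

(* [hK] is a phantom argument: the closure of the predicate under addition,
   hence the module structure of [ell2], depends on it. *)
Definition ell2_pred (_ : is_hilbert ip) : {pred I -> K} :=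
  fun x => `[< square_summable x >].

Lemma ell2_submod_closed : submod_closed (ell2_pred hK).
Proof.
split.
  by apply/asboolP; exists 0 => F; rewrite big1 // => i _; rewrite (nsq0 hK).
move=> a x y /asboolP[M hM] /asboolP[N hN]; apply/asboolP.
have a0 : 0 <= nsq cip a by apply: nsq_ge0; exact: cip_hilbert.
exists (2 * (nsq cip a * M) + 2 * N) => F.
apply: (@le_trans _ _ (\sum_(i <- F) (2 * (nsq cip a * nsq ip (x i)) + 2 * nsq ip (y i)))).
  apply: ler_sum => i _; rewrite -(nsqZ hK); exact: nsqD_le.
rewrite big_split /= -!mulr_sumr lerD // ler_wpM2l // ler_wpM2l //.
Qed.

HB.instance Definition _ :=
  GRing.isSubmodClosed.Build _ _ (ell2_pred hK) ell2_submod_closed.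

Record ell2 := Ell2 {ell2_fun :> I -> K; _ : ell2_fun \in ell2_pred hK}.

HB.instance Definition _ := [isSub for ell2_fun].
HB.instance Definition _ := [Choice of ell2 by <:].
HB.instance Definition _ := [SubChoice_isSubLmodule of ell2 by <:].

Implicit Types x y : ell2.

Lemma ell2_inj x y : (forall i, x i = y i) -> x = y.
Proof. by move=> h; apply/val_inj/funext. Qed.

Lemma ell2_bound x : square_summable x.
Proof. by case: x => x h; apply/asboolP. Qed.

Lemma ell2_lin (a : R[i]) x y i : (a *: x + y) i = a *: x i + y i.
Proof. by []. Qed.

(** The default 0 outside the square summable families lets operators be defined before their
    boundedness is known. *)
Definition to_ell2 (x : I -> K) : ell2 := insubd 0 x.

Lemma to_ell2E (x : I -> K) i : square_summable x -> to_ell2 x i = x i.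
Proof. by move=> h; rewrite /to_ell2 -[ell2_fun _]/(val _) insubdK //; apply/asboolP. Qed.

(** Finite sums are dominated by those of [nsq (x i) + nsq (y i)], whose tails are small. Tails
    below [min 1 eps] have squares below [eps]. *)
Lemma ell2_ip_summable x y : exists s, vsum cip (fun i => ip (x i) (y i) : R[i]^o) s.
Proof.
have [[M hM] [N hN]] := (ell2_bound x, ell2_bound y).
have sq z : forall F : {fset I}, 0 <= \sum_(i <- F) nsq ip (z i).
  by move=> F; apply: sumr_ge0 => i _; apply: nsq_ge0.
apply: (vsum_summable (@cip_hilbert R)) => eps e0.
pose r i := nsq ip (x i) + nsq ip (y i).
have r0 i : 0 <= r i by apply: addr_ge0; apply: nsq_ge0.
have hr (F : {fset I}) : \sum_(i <- F) r i <= M + N by rewrite big_split lerD.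
pose d := Num.min 1 eps.
have d0 : 0 < d by rewrite lt_min ltr01.
have [F hF] := sum_tail r0 hr d0; exists F => F' /hF hF'.
have r2 (G : {fset I}) : nsq cip (\sum_(i <- G) ip (x i) (y i)) <= (\sum_(i <- G) r i) ^+ 2.
  rewrite -norm_le_real; last by apply: sumr_ge0.
  apply: (le_trans (ler_norm_sum _ _ _)); rewrite rmorph_sum; apply: ler_sum => i _.
  rewrite norm_le_real //; apply: (le_trans (cauchy_schwarz hK _ _)).
  have := nsq_ge0 hK (x i); have := nsq_ge0 hK (y i); rewrite /r; nra.
apply: (le_lt_trans (r2 F')).
have s0 : 0 <= \sum_(i <- F') r i by apply: sumr_ge0.
by move: hF'; rewrite lt_min => /andP[h1 h2]; nra.
Qed.

(** The sum of the coordinatewise inner products; the default 0 is never taken, by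
    [ell2_ip_summable]. *)
Definition ell2_ip x y : R[i] :=
  xget 0 [set s | vsum cip (fun i => ip (x i) (y i) : R[i]^o) s]%classic.

Lemma ell2_ipP x y : vsum cip (fun i => ip (x i) (y i) : R[i]^o) (ell2_ip x y).
Proof.
rewrite /ell2_ip; case: xgetP => [s _ //|h].
by have [s /h] := ell2_ip_summable x y.
Qed.

Lemma ell2_ipE x y s : vsum cip (fun i => ip (x i) (y i) : R[i]^o) s -> ell2_ip x y = s.
Proof. exact: (vsum_uniq (@cip_hilbert R) (ell2_ipP x y)). Qed.

Lemma ell2_nsqP x : vsum cip (fun i => real_complex R (nsq ip (x i)) : R[i]^o)
  (ell2_ip x x).
Proof.
by have := ell2_ipP x x; congr (vsum _ _ _); apply/funext => i; rewrite (ip_nsq hK).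
Qed.

Lemma ell2_ip_pos x : 0 <= ell2_ip x x.
Proof. by apply: vsum_ge0 (ell2_nsqP x) => i; rewrite ler0c (nsq_ge0 hK). Qed.

Lemma ell2_ip_realE x : ell2_ip x x = real_complex R (nsq ell2_ip x).
Proof.
have := ell2_ip_pos x; rewrite lecE /nsq => /andP[/eqP h _].
by move: h; case: (ell2_ip x x) => a b /= ->.
Qed.

(** Subtracting from the full series its restriction to [F] leaves a series of nonnegative terms. *)
Lemma ell2_nsq_ge x (F : {fset I}) : \sum_(i <- F) nsq ip (x i) <= nsq ell2_ip x.
Proof.
have hF := vsum_fin (@cip_hilbert R)
  (x := fun i => if i \in F then real_complex R (nsq ip (x i)) : R[i]^o else 0).
have {}hF := hF F (fun i => ifN _ _).
have hn := vsum_map (@cip_hilbert R) (bounded_linear_scale (@cip_hilbert R) (-1)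
  (isometry_bounded_linear (J := id) (fun _ _ _ => erefl) (fun _ _ => erefl))) hF.
have := vsumD (@cip_hilbert R) (ell2_nsqP x) hn => /vsum_ge0 h.
have {h} : 0 <= ell2_ip x x + -1 * \sum_(i <- F) real_complex R (nsq ip (x i)).
  rewrite (eq_big_seq (fun i => if i \in F then real_complex R (nsq ip (x i)) else 0)).
    apply: h => i /=; case: ifP => _.
      by rewrite [_ *: _]mulN1r subrr.
    by rewrite scaler0 addr0 ler0c (nsq_ge0 hK).
  by move=> i ->.
rewrite mulN1r ell2_ip_realE -rmorph_sum -rmorphB ler0c; lra.
Qed.

Lemma ell2_nsq_le x M : (forall F : {fset I}, \sum_(i <- F) nsq ip (x i) <= M) ->
  nsq ell2_ip x <= M.
Proof.
move=> hM; rewrite leNgt; apply/negP => h.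
have d0 : 0 < (nsq ell2_ip x - M) ^+ 2 by rewrite exprn_gt0 // subr_gt0.
have [F /(_ F (fsubset_refl F))] := ell2_nsqP x d0.
rewrite -rmorph_sum ell2_ip_realE -rmorphB nsq_cip_real => k.
by have := hM F; nra.
Qed.

Lemma ell2_nsq_coord x i : nsq ip (x i) <= nsq ell2_ip x.
Proof. by have := ell2_nsq_ge x [fset i]%fset; rewrite big_seq_fset1. Qed.

Lemma ell2_hilbert : is_hilbert ell2_ip.
Proof.
apply: is_hilbert_intro.
- move=> a x y z; apply: ell2_ipE.
  have := vsumD (@cip_hilbert R) (vsum_map (@cip_hilbert R)
    (bounded_linear_scale (@cip_hilbert R) a (isometry_bounded_linear (J := id)
     (fun _ _ _ => erefl) (fun _ _ => erefl))) (ell2_ipP x z)) (ell2_ipP y z).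
  by congr (vsum _ _ _); apply/funext => i; rewrite -[LHS](ip_linear_l hK).
- move=> x y; apply: ell2_ipE.
  have := vsum_conj (ell2_ipP x y).
  by congr (vsum _ _ _); apply/funext => i /=; rewrite -(ipC hK).
- exact: ell2_ip_pos.
- move=> x x0; apply: ell2_inj => i; apply: (nsq_eq0 hK); apply/eqP.
  rewrite eq_le (nsq_ge0 hK) andbT; apply: (le_trans (ell2_nsq_coord x i)).
  by rewrite /nsq x0.
move=> u hu.
have hB n m i : u n i - u m i = (u n - u m) i by [].
have hlim i : exists l, forall eps : R, 0 < eps -> exists N : nat, forall n,
    (N <= n)%N -> nsq ip (u n i - l) < eps.
  apply: (hilbert_complete hK) => eps /hu[N hN]; exists N => n m nN mN.
  by rewrite hB; apply: le_lt_trans (hN _ _ nN mN); apply: ell2_nsq_coord.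
have [l hl] := choice hlim.
have hl_fin (F : {fset I}) eps : 0 < eps -> exists N : nat, forall n, (N <= n)%N ->
    \sum_(i <- F) nsq ip (u n i - l i) <= eps.
  elim/fset1U_rect: F eps => [eps e0|i F iF IH eps e0].
    by exists 0%N => n _; rewrite big_nil ltW.
  have e2 : 0 < eps / 2 by rewrite divr_gt0.
  have [N hN] := IH _ e2; have [M hM] := hl i _ e2.
  exists (maxn N M) => n; rewrite geq_max => /andP[/hN h1 /hM h2].
  by rewrite big_fsetU1 //=; lra.
(* [N] must not depend on [F]: the intermediate [u (maxn N M)] does, but its distance from [u n] is
   bounded by the Cauchy condition alone. *)
have key eps : 0 < eps -> exists N : nat, forall n, (N <= n)%N ->
    forall F : {fset I}, \sum_(i <- F) nsq ip (u n i - l i) <= eps.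
  move=> e0; have e4 : 0 < eps / 4 by rewrite divr_gt0.
  have [N hN] := hu _ e4; exists N => n nN F.
  have [M hM] := hl_fin F _ e4.
  have h1 := hN _ _ nN (leq_maxl N M); have h2 := hM _ (leq_maxr N M).
  have h3 := ell2_nsq_ge (u n - u (maxn N M)) F.
  apply: (@le_trans _ _ (\sum_(i <- F) (2 * nsq ip ((u n - u (maxn N M)) i) +
      2 * nsq ip (u (maxn N M) i - l i)))).
    by apply: ler_sum => i _; rewrite -hB; exact: nsqB_le.
  by rewrite big_split /= -!mulr_sumr; lra.
have [N hN] := key 1 ltr01.
(* The coordinatewise limit [l] is square summable because it differs from [u N] by a square
   summable family. *)
have dl : (fun i => u N i - l i) \in ell2_pred hK.
  by apply/asboolP; exists 1; apply: hN.
pose v : ell2 := u N - Ell2 dl.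
have vE i : v i = l i.
  by rewrite -[v i]/(u N i - (u N i - l i)) opprB addrC subrK.
exists v => eps e0; have [|M hM] := key (eps / 2); first by rewrite divr_gt0.
exists M => n /hM h.
have : nsq ell2_ip (u n - v) <= eps / 2.
  apply: ell2_nsq_le => F; have := h F; congr (_ <= _); apply: eq_bigr => i _.
  by rewrite -vE.
by lra.
Qed.

End Ell2.
Arguments to_ell2 {R} I {K ip} hK x.

(** * The Bram form *)

Section Bram.
Variable R : realType.

(** No adjoint occurs, so the condition can be transported by intertwining isometries. The index
    type is arbitrary to allow [option 'I_m], with [None] standing for the identity. *)
Definition bram (V : lmodType R[i]) (ip : V -> V -> R[i]) (I : finType)
    (S : I -> V -> V) : Prop :=
  forall x : I -> V, 0 <= \sum_i \sum_j ip (S i (x j)) (S j (x i)).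

Lemma big_option_sum (W : nmodType) (I : finType) (F : option I -> W) :
  \sum_i F i = F None + \sum_i F (Some i).
Proof.
rewrite (bigD1 None) //=; congr (_ + _).
rewrite (reindex_omap Some id) /=; last by case.
by apply: eq_bigl => i /=; rewrite eqxx.
Qed.

Variables (V : lmodType R[i]) (ip : V -> V -> R[i]).
Hypothesis hV : is_hilbert ip.

(* Minimising the quadratic form of [bram] over the component [x None]
   gives [x None = - \sum_j S_j^* x_j] and leaves the commutator form. *)
Lemma hyponormal_bram m (S : 'I_m -> V -> V) :
  (forall i, exists Sa, is_adjoint ip (S i) Sa) ->
  hyponormal_tuple ip S <-> bram ip (oapp S id).
Proof.
move=> exSa.
have key (Sa : 'I_m -> V -> V) (x : 'I_m -> V) x0 :
    (forall i, is_adjoint ip (S i) (Sa i)) ->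
    let y := \sum_j Sa j (x j) in
    \sum_i \sum_j ip (oapp S id i (oapp x x0 j)) (oapp S id j (oapp x x0 i)) =
    ip (x0 + y) (x0 + y) + \sum_(i < m) \sum_(j < m)
            ip (Sa j (S i (x j)) - S i (Sa j (x j))) (x i).
  move=> hSa y.
  have hSa' i u v : ip (Sa i u) v = ip u (S i v).
    by rewrite (ipC hV) -hSa -(ipC hV).
  rewrite big_option_sum /= big_option_sum /=.
  under [X in _ + X = _]eq_bigr do rewrite big_option_sum /=.
  rewrite big_split /=.
  have -> : \sum_(i < m) \sum_(j < m) ip (Sa j (S i (x j)) - S i (Sa j (x j))) (x i) =
      \sum_(i < m) \sum_(j < m) ip (S i (x j)) (S j (x i)) - ip y y.
    rewrite {2}/y (ip_sumr hV) -sumrB; apply: eq_bigr => i _.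
    rewrite /y (ip_suml hV) -sumrB; apply: eq_bigr => j _.
    by rewrite (ipDl hV) (ipNl hV) hSa' [ip (S i (Sa _ _)) _]hSa.
  rewrite !(ipDl hV) !(ipDr hV).
  have -> : \sum_(j < m) ip (x j) (S j x0) = ip y x0.
    by rewrite /y (ip_suml hV); apply: eq_bigr => j _; rewrite hSa'.
  have -> : \sum_(j < m) ip (S j x0) (x j) = ip x0 y.
    by rewrite /y (ip_sumr hV); apply: eq_bigr => j _; rewrite hSa.
  by ring.
split=> [hS x|hS Sa hSa x].
  have [Sa hSa] := choice exSa.
  have := key Sa (x \o some) (x None) hSa.
  have -> : oapp (x \o some) (x None) = x by apply/funext; case.
  move=> ->; apply: addr_ge0; first exact: ip_ge0.
  exact: hS.
have := hS (oapp x (- \sum_j Sa j (x j))); rewrite (key Sa) //.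
by rewrite addNr (ip0l hV) add0r.
Qed.

(** Evaluate the form of [S] at the sums of [x] over the fibres of [tau]. Operators may thus be
    repeated or left out. *)
Lemma bram_pullback (I J : finType) (tau : I -> J) (S : J -> V -> V) :
  (forall j, is_linear_map (S j)) -> bram ip S -> bram ip (S \o tau).
Proof.
move=> lS hS x; have := hS (fun b => \sum_(i | tau i == b) x i).
congr (0 <= _).
rewrite [RHS](partition_big tau predT) //=; apply: eq_bigr => a _.
rewrite [RHS]exchange_big /= [RHS](partition_big tau predT) //=.
apply: eq_bigr => b _.
rewrite (lin_map_sum (lS a)) (ip_suml hV); apply: eq_bigr => j /eqP jb.
rewrite (lin_map_sum (lS b)) (ip_sumr hV); apply: eq_bigr => i /eqP ia.
by rewrite ia jb.
Qed.

(** The factor [a i * conj (a j)] of the term [(i, j)] is absorbed by replacing each [x i] with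
    [conj (a i) *: x i]. *)
Lemma bram_scale (I : finType) (a : I -> R[i]) (S : I -> V -> V) :
  (forall i, is_linear_map (S i)) -> bram ip S ->
  bram ip (fun i x => a i *: S i x).
Proof.
move=> lS hS x; have := hS (fun i => Num.conj (a i) *: x i).
congr (0 <= _); apply: eq_bigr => i _; apply: eq_bigr => j _.
rewrite !(lin_mapZ (lS _)) !(ipZl hV) !(ipZr hV) conjCK.
by ring.
Qed.

Lemma bram_isometry (U : lmodType R[i]) (ipU : U -> U -> R[i]) (I : finType)
    (J : U -> V) (S : I -> V -> V) (S' : I -> U -> U) :
  (forall x y, ip (J x) (J y) = ipU x y) ->
  (forall i x, J (S' i x) = S i (J x)) -> bram ip S -> bram ipU S'.
Proof.
move=> iJ hJ hS x; have := hS (J \o x).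
by congr (0 <= _); apply: eq_bigr => i _; apply: eq_bigr => j _; rewrite -iJ !hJ.
Qed.

(* After the substitution [v := h - g i - g j] the inner products in
   [ell2_ip] become, for each [v], an instance of the form for [S]. *)
Lemma bram_twist (A : zmodType) (U : lmodType R[i]) (ipU : U -> U -> R[i])
    (I : finType) (J : U -> ell2 A hV) (S : I -> V -> V) (S' : I -> U -> U)
    (g : I -> A) :
  (forall x y, ell2_ip (J x) (J y) = ipU x y) ->
  (forall i x h, J (S' i x) h = S i (J x (h - g i))) ->
  bram ip S -> bram ipU S'.
Proof.
move=> iJ hJ hS x.
pose t i j v := ip (S i (J (x j) (v + g j))) (S j (J (x i) (v + g i))).
have ht i j : vsum cip (t i j : A -> R[i]^o) (ipU (S' i (x j)) (S' j (x i))).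
  have b : bijective (fun v : A => v + (g i + g j)).
    by exists (fun v => v - (g i + g j)) => v; rewrite ?addrK ?subrK.
  have := vsum_reindex b (ell2_ipP (J (S' i (x j))) (J (S' j (x i)))).
  rewrite iJ; congr (vsum _ _ _); apply/funext => v /=.
  by rewrite !hJ /t [g i + g j]addrC addrA addrK addrAC addrK.
have hs i := vsum_sum (index_enum I) (@cip_hilbert R) (ht i).
have := vsum_sum (index_enum I) (@cip_hilbert R) hs.
by move=> /vsum_ge0; apply => v; apply: (hS (fun j => J (x j) (v + g j))).
Qed.

End Bram.

(** * Twisting by shifts *)

Section Operators.
Variables (R : realType) (V : lmodType R[i]) (ip : V -> V -> R[i]).
Hypothesis hV : is_hilbert ip.

Lemma ip_inj u v : (forall x, ip x u = ip x v) -> u = v.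
Proof.
move=> h; apply/eqP; rewrite -subr_eq0; apply/eqP/(ip_definite hV).
by rewrite (ipDr hV) (ipNr hV) h subrr.
Qed.

(** Cauchy-Schwarz applied to [nsq (Ta y) = ip (T (Ta y)) y] yields the bound [M] of [T] again. *)
Lemma adjoint_bounded_linear T Ta :
  bounded_linear ip ip T -> is_adjoint ip T Ta -> bounded_linear ip ip Ta.
Proof.
move=> [lT [M M0 hM]] hT; split.
  move=> a x y; apply: ip_inj => z.
  by rewrite -hT !(ipDr hV) !(ipZr hV) -!hT.
exists M => // y; have h := cauchy_schwarz hV (T (Ta y)) y.
rewrite hT (ip_nsq hV) nsq_cip_real in h.
have := hM (Ta y); have n0 := nsq_ge0 hV (Ta y); have y0 := nsq_ge0 hV y => h2.
have {h h2} : nsq ip (Ta y) ^+ 2 <= M * nsq ip (Ta y) * nsq ip y.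
  by apply: (le_trans h); rewrite ler_wpM2r.
by move: n0; rewrite le_eqVlt => /predU1P[<-|n0]; [rewrite mulr_ge0 | nra].
Qed.

Lemma adjoint_comp S Sa T Ta : is_adjoint ip S Sa -> is_adjoint ip T Ta ->
  is_adjoint ip (S \o T) (Ta \o Sa).
Proof. by move=> hS hT x y /=; rewrite hS hT. Qed.

Lemma adjoint_iter n T Ta : is_adjoint ip T Ta ->
  is_adjoint ip (iter n T) (iter n Ta).
Proof.
move=> hT; elim: n => [|n IH] x y //.
by rewrite iterS hT IH -iterSr.
Qed.

Lemma normal_scale (a : R[i]) N :
  is_normal_op ip N -> is_normal_op ip (fun x => a *: N x).
Proof.
move=> [/(bounded_linear_op hV) bN [Na [hN cN]]].
have bNa := adjoint_bounded_linear bN hN; split.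
  by apply/(bounded_linear_op hV)/(bounded_linear_scale hV).
exists (fun x => Num.conj a *: Na x); split=> [x y|y].
  by rewrite (ipZl hV) (ipZr hV) conjCK hN.
by rewrite (lin_mapZ bN.1) (lin_mapZ bNa.1) cN !scalerA mulrC.
Qed.

Lemma iter_linear n (T : V -> V) : is_linear_map T -> is_linear_map (iter n T).
Proof. by move=> lT a x y; elim: n => //= n ->; rewrite lT. Qed.

Lemma iter_scale n (a : R[i]) (T : V -> V) x : is_linear_map T ->
  iter n (fun y => a *: T y) x = a ^+ n *: iter n T x.
Proof.
move=> lT; elim: n => [|n IH] /=; first by rewrite expr0 scale1r.
by rewrite IH (lin_mapZ lT) scalerA -exprS.
Qed.

End Operators.

(** * Tensoring an operator with a translation of the group *)

Section Lift.
Variables (R : realType) (A : zmodType) (K : lmodType R[i]).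
Variables (ip : K -> K -> R[i]) (hK : is_hilbert ip).

Local Notation ell := (ell2 A hK).
Local Notation ipl := (@ell2_ip R A K ip hK).

(** The operator [T (x) U^u] on [K (x) l^2(A)], with [U^u] the translation by [u]. *)
Definition lift_shift (T : K -> K) (u : A) (x : ell) : ell :=
  to_ell2 A hK (fun h => T (x (h - u))).

(** Translation only moves the finite set [F]. The estimate serves twice: for square summability of
    the image and for the operator bound. *)
Lemma sum_shift_le (T : K -> K) M (u : A) (x : ell) (F : {fset A}) :
  0 <= M -> (forall y, nsq ip (T y) <= M * nsq ip y) ->
  \sum_(h <- F) nsq ip (T (x (h - u))) <= M * nsq ipl x.
Proof.
move=> M0 hM; apply: (@le_trans _ _ (\sum_(h <- F) M * nsq ip (x (h - u)))).
  by apply: ler_sum => h _; apply: hM.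
rewrite -mulr_sumr ler_wpM2l //.
have := ell2_nsq_ge x [fset h - u | h in F]%fset.
by rewrite big_imfset //= => i j _ _ /addIr.
Qed.

Lemma lift_shiftE T u x h : bounded_linear ip ip T ->
  lift_shift T u x h = T (x (h - u)).
Proof.
move=> [_ [M M0 hM]]; rewrite /lift_shift to_ell2E //.
by exists (M * nsq ipl x) => F; apply: sum_shift_le.
Qed.

Lemma lift_shift_bounded T u :
  bounded_linear ip ip T -> bounded_linear ipl ipl (lift_shift T u).
Proof.
move=> bT; have [lT [M M0 hM]] := bT; split.
  by move=> a x y; apply: ell2_inj => h; rewrite ell2_lin !lift_shiftE // ell2_lin lT.
exists M => // x; apply: ell2_nsq_le => F.
by under eq_bigr do rewrite lift_shiftE //; apply: sum_shift_le.
Qed.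

(** Reindexing by [h - u] makes the series of the two inner products agree term by term. *)
Lemma lift_shift_adjoint T Ta u : bounded_linear ip ip T -> is_adjoint ip T Ta ->
  is_adjoint ipl (lift_shift T u) (lift_shift Ta (- u)).
Proof.
move=> bT hT x y; have bTa := adjoint_bounded_linear hK bT hT.
apply: ell2_ipE.
have b : bijective (fun h : A => h - u).
  by exists (fun h => h + u) => h; rewrite ?addrK ?subrK.
have := vsum_reindex b (ell2_ipP x (lift_shift Ta (- u) y)).
congr (vsum _ _ _); apply/funext => h /=.
by rewrite !lift_shiftE // hT opprK subrK.
Qed.

Lemma lift_shift_comm S T u v y : bounded_linear ip ip S -> bounded_linear ip ip T ->
  (forall z, S (T z) = T (S z)) ->
  lift_shift S u (lift_shift T v y) = lift_shift T v (lift_shift S u y).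
Proof.
move=> bS bT ST; apply: ell2_inj => h; rewrite !lift_shiftE // ST.
by rewrite -!addrA [- u - v]addrC.
Qed.

Lemma lift_shift_normal N u :
  is_normal_op ip N -> is_normal_op ipl (lift_shift N u).
Proof.
move=> [/(bounded_linear_op hK) bN [Na [hN cN]]]; split.
  by apply/(bounded_linear_op (ell2_hilbert A hK))/lift_shift_bounded.
exists (lift_shift Na (- u)); split; first exact: lift_shift_adjoint.
by move=> y; apply: lift_shift_comm => //; apply: (adjoint_bounded_linear hK bN hN).
Qed.

Lemma ell2_coord_bounded (h : A) : bounded_linear ipl ip (fun x : ell => x h).
Proof.
split; first by move=> a x y; rewrite ell2_lin.
by exists 1 => // x; rewrite mul1r ell2_nsq_coord.
Qed.

(** The elementary tensor of [v] with the basis vector at [u]. *)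
Definition ell2_delta (u : A) (v : K) : ell :=
  to_ell2 A hK (fun h => if h == u then v else 0).

Lemma ell2_deltaE u v h : ell2_delta u v h = if h == u then v else 0.
Proof.
rewrite /ell2_delta to_ell2E //.
exists (nsq ip v) => F; have [uF|uF] := boolP (u \in F).
  rewrite (big_fsetD1 u uF) /= eqxx big1_fset ?addr0 // => i.
  by rewrite !inE => /andP[/negPf -> _]; rewrite (nsq0 hK).
rewrite big1_fset ?nsq_ge0 // => i iF _; case: eqP => [e|_]; last exact: nsq0.
by rewrite -e iF in uF.
Qed.

Lemma ell2_ip_delta u u' v v' :
  ipl (ell2_delta u v) (ell2_delta u' v') = if u == u' then ip v v' else 0.
Proof.
apply: ell2_ipE.
have -> : (if u == u' then ip v v' else 0) =
    \sum_(h <- [fset u]%fset) ip (ell2_delta u v h) (ell2_delta u' v' h).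
  rewrite big_seq_fset1 !ell2_deltaE eqxx; case: eqP => // _.
  by rewrite (ip0r hK).
apply: vsum_fin => [|h]; first exact: cip_hilbert.
by rewrite inE !ell2_deltaE => /negPf ->; rewrite (ip0l hK).
Qed.

End Lift.

(** * The isometry into the space over Z^2 *)

Section Embedding.
Variables (R : realType) (H2 K : lmodType R[i]).
Variables (ip2 : H2 -> H2 -> R[i]) (ipK : K -> K -> R[i]).
Hypotheses (h2 : is_hilbert ip2) (hK : is_hilbert ipK).
Variables (f : nat * nat -> H2) (a : nat -> K).
Hypothesis bf : is_orthonormal_basis ip2 f.
Hypothesis oa : forall i j, ipK (a i) (a j) = (if i == j then 1 else 0).

(** Passing to the group Z^2 makes translations invertible, so that lifts of normal operators are
    normal. *)
Definition int_pair (k : nat * nat) : int * int := (k.1%:Z, k.2%:Z).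

Lemma int_pair_eq k l : (int_pair k == int_pair l) = (k == l).
Proof. by case: k l => [? ?] [? ?]; rewrite /int_pair !xpair_eqE /= !eqz_nat. Qed.

(* [H2] sits in [K (x) l^2(Z^2)] as the closed span of the [a_|k| (x) delta_k]:
   an operator shifting the [f_k] by [u] becomes [N (x) U^u]. *)
Lemma twisted_embedding : exists J : H2 -> ell2 (int * int)%type hK,
  [/\ is_linear_map J, (forall x y, ell2_ip (J x) (J y) = ip2 x y) &
   forall (T : H2 -> H2) (N : K -> K) (s : nat * nat -> nat * nat)
     (u : int * int) (w : nat * nat -> R[i]),
     bounded_linear ip2 ip2 T -> bounded_linear ipK ipK N ->
     (forall k, T (f k) = w k *: f (s k)) ->
     (forall k, int_pair (s k) = int_pair k + u) ->
     (forall k, N (a (k.1 + k.2)%N) = w k *: a ((s k).1 + (s k).2)%N) ->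
     forall x h, J (T x) h = N (J x (h - u))].
Proof.
pose g k := ell2_delta hK (int_pair k) (a (k.1 + k.2)%N).
have hl := ell2_hilbert (int * int)%type hK.
have og i j : ell2_ip (g i) (g j) = (if i == j then 1 else 0).
  rewrite ell2_ip_delta int_pair_eq; case: eqP => // ->.
  by rewrite oa eqxx.
have [J [lJ iJ Jf]] := isometry_extension h2 bf hl og.
exists J; split=> // T N s u w bT bN Tf su Na x h.
have bJ := isometry_bounded_linear lJ iJ.
apply: (bounded_linear_ext h2 bf hK
  (bounded_linear_comp bT (bounded_linear_comp bJ (ell2_coord_bounded hK h)))
  (bounded_linear_comp (bounded_linear_comp bJ (ell2_coord_bounded hK (h - u))) bN)).
move=> k /=; rewrite Tf (lin_mapZ lJ) !Jf.
(* Both sides vanish unless [h = int_pair k + u], where the hypothesis on [N] makes them equal. *)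
rewrite -[LHS]/(w k *: g (s k) h) !ell2_deltaE su subr_eq.
by case: eqP => _; rewrite ?Na // (lin_map0 bN.1) scaler0.
Qed.

End Embedding.

(** * The canonical embedding *)

Lemma subnormal_scale (R : realType) (V : lmodType R[i]) (ip : V -> V -> R[i])
    (S T : V -> V) (c : R[i]) :
  (forall x, T x = c *: S x) -> subnormal ip S -> subnormal ip T.
Proof.
move=> TS [K [ipK [J [N [hK [lJ iJ] nN cN JN]]]]].
exists K, ipK, J, (fun i x => c *: N i x); split=> //.
- by move=> i; apply: normal_scale.
- move=> i j y /=; rewrite (lin_mapZ (nN i).1.1) cN.
  by rewrite -(lin_mapZ (nN j).1.1).
- by move=> i x; rewrite TS (lin_mapZ lJ) JN.
Qed.

Lemma k_hyponormal_bram (R : realType) (V : lmodType R[i]) (ip : V -> V -> R[i])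
    (I : choiceType) (e : I -> V) k (T : V -> V) :
  is_hilbert ip -> is_orthonormal_basis ip e -> bounded_linear ip ip T ->
  k_hyponormal ip k T <-> bram ip (oapp (fun i : 'I_k => iter i.+1 T) id).
Proof.
move=> hV be bT; apply: hyponormal_bram => // i.
have [Ta hT] := adjoint_exists hV be bT.
by exists (iter i.+1 Ta); apply: adjoint_iter.
Qed.

Lemma k_hyponormal_scale (R : realType) (V : lmodType R[i]) (ip : V -> V -> R[i])
    (I : choiceType) (e : I -> V) k (S T : V -> V) (c : R[i]) :
  is_hilbert ip -> is_orthonormal_basis ip e ->
  bounded_linear ip ip S -> bounded_linear ip ip T ->
  (forall x, T x = c *: S x) -> k_hyponormal ip k S -> k_hyponormal ip k T.
Proof.
move=> hV be bS bT TS /(k_hyponormal_bram k hV be bS) h.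
apply/(k_hyponormal_bram k hV be bT).
have lS (i : option 'I_k) : is_linear_map (oapp (fun i : 'I_k => iter i.+1 S) id i).
  by case: i => [i|] //=; apply: (iter_linear i.+1 bS.1).
(* The power [i.+1] is scaled by [c ^+ i.+1], the adjoined identity by 1. *)
have := bram_scale hV (oapp (fun i : 'I_k => c ^+ i.+1) 1) lS h.
congr bram; apply/funext => -[i|]; apply/funext => x; last by rewrite /= scale1r.
rewrite [LHS]/= -[c ^+ i.+1 *: _](iter_scale i.+1 c x bS.1).
by have -> : T = (fun y => c *: S y) by apply/funext.
Qed.

Lemma hyponormal_1 (R : realType) (V : lmodType R[i]) (ip : V -> V -> R[i])
    (T : V -> V) : hyponormal ip T = k_hyponormal ip 1 T.
Proof.
rewrite /hyponormal /k_hyponormal; congr hyponormal_tuple.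
by apply/funext => i; rewrite ord1.
Qed.

(** * Transfer between the pair and the one-variable shift *)

Section CanonicalEmbedding.
Variables (R : realType) (H H2 : lmodType R[i]).
Variables (ipH : H -> H -> R[i]) (ip2 : H2 -> H2 -> R[i]).
Hypotheses (hH : is_hilbert ipH) (h2 : is_hilbert ip2).
Variables (e : nat -> H) (f : nat * nat -> H2).
Hypotheses (be : is_orthonormal_basis ipH e) (bf : is_orthonormal_basis ip2 f).
Variables (om : nat -> R[i]) (c : R[i]) (W : H -> H) (T1 T2 : H2 -> H2).
Hypotheses (bW : bounded_linear ipH ipH W).
Hypotheses (bT1 : bounded_linear ip2 ip2 T1) (bT2 : bounded_linear ip2 ip2 T2).
Hypothesis We : forall n, W (e n) = om n *: e n.+1.
Hypothesis T1f : forall k, T1 (f k) = om (k.1 + k.2)%N *: f (k.1.+1, k.2).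
Hypothesis T2f : forall k, T2 (f k) = (c * om (k.1 + k.2)%N) *: f (k.1, k.2.+1).

(** Sends [e n] to [f (n, 0)]; along this row [T1] has the weights of [W]. *)
Lemma row_isometry : exists J : H -> H2,
  [/\ is_linear_map J, (forall x y, ip2 (J x) (J y) = ipH x y) &
      forall x, J (W x) = T1 (J x)].
Proof.
have og i j : ip2 (f (i, 0%N)) (f (j, 0%N)) = if i == j then 1 else 0.
  by rewrite bf.1 xpair_eqE eqxx andbT.
have [J [lJ iJ Je]] := isometry_extension hH be h2 og.
exists J; split=> //; have bJ := isometry_bounded_linear lJ iJ.
apply: (bounded_linear_ext hH be h2 (bounded_linear_comp bW bJ)
  (bounded_linear_comp bJ bT1)) => n /=.
by rewrite We (lin_mapZ lJ) !Je T1f addn0.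
Qed.

(** [N] is only required to act as the weighted shift on an orthonormal sequence: it will be [W]
    itself for hyponormality and a normal extension of [W] for subnormality. *)
Lemma canonical_twist (K : lmodType R[i]) (ipK : K -> K -> R[i])
    (hK : is_hilbert ipK) (a : nat -> K) (N : K -> K) :
  (forall i j, ipK (a i) (a j) = (if i == j then 1 else 0)) ->
  bounded_linear ipK ipK N -> (forall n, N (a n) = om n *: a n.+1) ->
  exists J : H2 -> ell2 (int * int)%type hK,
  [/\ is_linear_map J, (forall x y, ell2_ip (J x) (J y) = ip2 x y),
      (forall x h, J (T1 x) h = N (J x (h - (1, 0)))) &
      (forall x h, J (T2 x) h = c *: N (J x (h - (0, 1))))].
Proof.
move=> oa bN Na; have [J [lJ iJ hJ]] := twisted_embedding h2 hK bf oa.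
exists J; split=> //.
  apply: (hJ T1 N _ _ _ bT1 bN T1f) => [[k l]|k] /=; last by rewrite Na.
  by congr pair; rewrite ?addr0 // -addn1 PoszD.
apply: (hJ T2 _ _ _ _ bT2 (bounded_linear_scale hK c bN) T2f) => [[k l]|k] /=.
  by congr pair; rewrite ?addr0 // -addn1 PoszD.
by rewrite Na scalerA addnS.
Qed.

Definition monomial (pq : nat * nat) (x : H2) : H2 := iter pq.1 T1 (iter pq.2 T2 x).

(** Treats hyponormality of the pair ([k = 1]) and [k]-hyponormality together. Restriction to the
    row uses that every [T1^n] with [0 < n <= k] occurs; the converse uses the degree bound. *)
Lemma hyponormal_monomials k m (d : 'I_m -> nat * nat) :
  (forall i, 0 < (d i).1 + (d i).2 <= k)%N ->
  (forall n, (0 < n <= k)%N -> exists i, d i = (n, 0%N)) ->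
  hyponormal_tuple ip2 (fun i => monomial (d i)) <-> k_hyponormal ipH k W.
Proof.
move=> hd dh.
have adj i : exists Sa, is_adjoint ip2 (monomial (d i)) Sa.
  have [T1a h1] := adjoint_exists h2 bf bT1; have [T2a ha2] := adjoint_exists h2 bf bT2.
  eexists; exact: (adjoint_comp (adjoint_iter (d i).1 h1) (adjoint_iter (d i).2 ha2)).
split=> [/(hyponormal_bram h2 adj)|/(k_hyponormal_bram k hH be bW)] h.
  apply/(k_hyponormal_bram k hH be bW).
  have [J [lJ iJ JW]] := row_isometry.
  have [i0 hi0] := choice (fun i : 'I_k => dh i.+1 (ltn_ord i)).
  have lP (i : option 'I_m) : is_linear_map (oapp (fun i => monomial (d i)) id i).
    case: i => [i|] //= b x y; rewrite /monomial.
    by rewrite (iter_linear _ bT2.1) (iter_linear _ bT1.1).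
  (* Keep only the pure powers of [T1], which the row isometry intertwines with the powers of
     [W]. *)
  have hp := bram_pullback h2 (omap i0) lP h.
  apply: (bram_isometry iJ _ hp) => -[i|] //= x.
  rewrite /monomial hi0 /= JW; congr (T1 _).
  by elim: (val i) => //= n <-; rewrite JW.
apply/(hyponormal_bram h2 adj).
have [J [lJ iJ J1 J2]] := canonical_twist hH be.1 bW We.
have lW (i : option 'I_k) : is_linear_map (oapp (fun i : 'I_k => iter i.+1 W) id i).
  by case: i => [i|] //=; apply: (iter_linear i.+1 bW.1).
(* The predecessor appears because index [i] stands for the power [i.+1] of [W]. *)
have hlt i : (((d i).1 + (d i).2).-1 < k)%N.
  by case/andP: (hd i); case: (_ + _)%N.
(* Under [J] the monomial [(p, q)] becomes [c ^+ q] times [W^(p + q)], translated by [(p, q)]: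
   repeat each power of [W] once per monomial of that degree, rescale, then twist. *)
have hp := bram_pullback hH (omap (fun i => Ordinal (hlt i))) lW h.
have hs := bram_scale hH (oapp (fun i => c ^+ (d i).2) 1) (fun i => lW _) hp.
apply: (bram_twist (g := oapp (fun i => int_pair (d i)) 0) iJ _ hs) => -[i|] x u /=;
  last by rewrite subr0 scale1r.
rewrite -iterS prednK; last by case/andP: (hd i).
rewrite /monomial; case: (d i) => p q /=.
(* Each factor adds a unit vector to the translation, and each [T2] also contributes a [c]. *)
elim: p u => [|p IH] u /=.
  elim: q u => [|q IH] u /=; first by rewrite scale1r subr0.
  rewrite J2 IH (lin_mapZ bW.1) scalerA -exprS -[(0 + q)%N]/q.
  congr (_ *: W (iter q W (J x _))).
  by rewrite -addrA -opprD; congr (u - _); congr pair; rewrite ?addr0 //.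
rewrite J1 IH (lin_mapZ bW.1); congr (_ *: W (iter _ W (J x _))).
by rewrite -addrA -opprD; congr (u - _); congr pair; rewrite ?add0r.
Qed.

Lemma hyponormal_pair_shift : hyponormal_pair ip2 T1 T2 <-> hyponormal ipH W.
Proof.
rewrite hyponormal_1.
pose d (i : 'I_2) := if val i == 0%N then (1, 0)%N else (0, 1)%N.
have -> : hyponormal_pair ip2 T1 T2 = hyponormal_tuple ip2 (fun i => monomial (d i)).
  by congr hyponormal_tuple; apply/funext => i; rewrite /d; case: ifP.
apply: hyponormal_monomials => [i|[|[|n]]] //; first by rewrite /d; case: ifP.
by exists ord0.
Qed.

Lemma k_hyponormal_pair_shift k :
  k_hyponormal_pair ip2 k T1 T2 <-> k_hyponormal ipH k W.
Proof.
pose d (i : 'I_(size (monomial_exps k))) := nth (0, 0)%N (monomial_exps k) i.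
have mem pq : (pq \in monomial_exps k) = (0 < pq.1 + pq.2 <= k)%N.
  apply/allpairsPdep/idP => [[n [p []]]|].
    rewrite !mem_iota !add0n !add1n !ltnS => hn /andP[_ hp] ->.
    by rewrite /= subnKC.
  case: pq => p q h; exists (p + q)%N, p.
  by rewrite !mem_iota add0n add1n !ltnS leq_addr addKn.
apply: (@hyponormal_monomials k _ d) => [i|n hn].
  by rewrite -mem mem_nth.
have hm : (n, 0%N) \in monomial_exps k by rewrite mem /= addn0.
have hi : (index (n, 0%N) (monomial_exps k) < size (monomial_exps k))%N by rewrite index_mem.
by exists (Ordinal hi); rewrite /d /= nth_index.
Qed.

Lemma subnormal_pair_shift : subnormal_pair ip2 T1 T2 <-> subnormal ipH W.
Proof.
split=> [|] [K [ipK [J0 [N [hK [lJ0 iJ0] nN cN JN]]]]].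
  have [J [lJ iJ JW]] := row_isometry.
  (* The normal extension of [T1] extends [W] through the row. *)
  exists K, ipK, (J0 \o J), (fun=> N ord0); split=> //.
  - by split=> [b x y|x y] /=; rewrite ?lJ ?lJ0 ?iJ0.
  - by move=> i x /=; rewrite JN JW.
pose N0 := N ord0.
have bN : bounded_linear ipK ipK N0 by apply/(bounded_linear_op hK); case: (nN ord0).
have oa i j : ipK (J0 (e i)) (J0 (e j)) = (if i == j then 1 else 0).
  by rewrite iJ0 be.1.
have Na n : N0 (J0 (e n)) = om n *: J0 (e n.+1) by rewrite /N0 JN We (lin_mapZ lJ0).
have [J [lJ iJ J1 J2]] := canonical_twist hK oa bN Na.
have bN' := bounded_linear_scale hK c bN.
have comm z : N0 (c *: N0 z) = c *: N0 (N0 z) by rewrite (lin_mapZ bN.1).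
(* The lifts commute because [N0] commutes with [c *: N0] and translations commute. *)
exists (ell2 (int * int)%type hK), (@ell2_ip _ _ _ _ hK), J,
  (fun i : 'I_2 => if val i == 0%N then lift_shift N0 (1, 0)
                   else lift_shift (fun x => c *: N0 x) (0, 1)).
split=> //.
- exact: ell2_hilbert.
- move=> i; case: ifP => _; apply: lift_shift_normal; first exact: nN.
  by apply: normal_scale => //; exact: nN.
- move=> i j y; case: ifP => _; case: ifP => _ //; apply: lift_shift_comm => // z.
- by move=> i x; case: ifP => _; apply: ell2_inj => h; rewrite lift_shiftE ?J1 ?J2.
Qed.

End CanonicalEmbedding.

(** Comparing [T1 T2] and [T2 T1] at [f (n, 0)] gives [eta n * om n.+1 = om n * eta n.+1], so the
    ratio [eta n / om n] is constant. *)
Lemma commuting_weights (R : realType) (H2 : lmodType R[i])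
    (ip2 : H2 -> H2 -> R[i]) (f : nat * nat -> H2) (om eta : nat -> R)
    (T1 T2 : H2 -> H2) :
  is_hilbert ip2 -> (forall n, 0 < om n) -> (forall n, 0 < eta n) ->
  is_canonical_embedding ip2 f om eta T1 T2 ->
  (forall x, T1 (T2 x) = T2 (T1 x)) ->
  exists2 c : R, 0 < c & forall n, eta n = c * om n.
Proof.
move=> h2 om0 eta0 [[onf _] [lT1 _] [lT2 _] T1f T2f] comm.
exists (eta 0%N / om 0%N) => [|n]; first exact: divr_gt0.
elim: n => [|n IH]; first by rewrite divfK // gt_eqF.
have := comm (f (n, 0%N)).
rewrite T1f T2f (lin_mapZ lT1) (lin_mapZ lT2) T1f T2f !addn0 addn1 !scalerA.
move=> /(congr1 (fun x => ip2 x (f (n.+1, 1%N)))).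
rewrite !(ipZl h2) onf eqxx !mulr1 -!rmorphM => /complexI h.
apply: (mulfI (lt0r_neq0 (om0 n))).
by rewrite -h IH; ring.
Qed.

Theorem theorem3p12 (R : realType)
    (H : lmodType R[i]) (ipH : H -> H -> R[i]) (e : nat -> H)
    (H2 : lmodType R[i]) (ip2 : H2 -> H2 -> R[i]) (f : nat * nat -> H2)
    (om eta : nat -> R) (Wom Weta : H -> H) (T1 T2 : H2 -> H2) :
  is_hilbert ipH -> is_hilbert ip2 ->
  (forall n, 0 < om n) -> (forall n, 0 < eta n) ->
  (exists M : R, forall n, om n <= M) -> (exists M : R, forall n, eta n <= M) ->
  is_weighted_shift ipH e om Wom -> is_weighted_shift ipH e eta Weta ->
  is_canonical_embedding ip2 f om eta T1 T2 ->
  (forall x, T1 (T2 x) = T2 (T1 x)) ->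
  [/\ (hyponormal_pair ip2 T1 T2 <-> hyponormal ipH Wom) /\
        (hyponormal ipH Wom <-> hyponormal ipH Weta),
      (forall k : nat, (1 <= k)%N ->
        (k_hyponormal_pair ip2 k T1 T2 <-> k_hyponormal ipH k Wom) /\
        (k_hyponormal ipH k Wom <-> k_hyponormal ipH k Weta)) &
      (subnormal_pair ip2 T1 T2 <-> subnormal ipH Wom) /\
        (subnormal ipH Wom <-> subnormal ipH Weta)].
Proof.
move=> hH h2 om0 eta0 _ _ [be [/(bounded_linear_op hH) bW We]]
  [_ [/(bounded_linear_op hH) bWeta Wetae]] emb comm.
have [c c0 etac] := commuting_weights h2 om0 eta0 emb comm.
have [bf /(bounded_linear_op h2) bT1 /(bounded_linear_op h2) bT2 T1f T2f] := emb.
pose C := real_complex R c; pose omC n := real_complex R (om n).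
have C0 : C != 0 by rewrite fmorph_eq0 gt_eqF.
(* Both shifts act on the same basis [e], so proportional weights give proportional operators. *)
have scale x : Weta x = C *: Wom x.
  apply: (bounded_linear_ext hH be hH bWeta (bounded_linear_scale hH C bW)) => n.
  by rewrite We Wetae etac scalerA rmorphM.
have scale' x : Wom x = C^-1 *: Weta x by rewrite scale scalerA mulVf ?scale1r.
have T1f' k : T1 (f k) = omC (k.1 + k.2)%N *: f (k.1.+1, k.2).
  by case: k => k l; rewrite T1f.
have T2f' k : T2 (f k) = (C * omC (k.1 + k.2)%N) *: f (k.1, k.2.+1).
  by case: k => k l; rewrite T2f etac rmorphM.
have khyp k : k_hyponormal ipH k Wom <-> k_hyponormal ipH k Weta.
  split; first exact: (k_hyponormal_scale hH be bW bWeta scale).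
  exact: (k_hyponormal_scale hH be bWeta bW scale').
split; first split.
- exact: (hyponormal_pair_shift hH h2 be bf bW bT1 bT2 (om := omC) We T1f' T2f').
- by rewrite !hyponormal_1.
- move=> k _; split=> //.
  exact: (k_hyponormal_pair_shift hH h2 be bf bW bT1 bT2 (om := omC) We T1f' T2f').
split; first exact: (subnormal_pair_shift hH h2 be bf bW bT1 bT2 (om := omC) We T1f' T2f').
by split; [apply: subnormal_scale scale | apply: subnormal_scale scale'].
Qed.
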